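(* Let $w_1>w_2>\dots>w_n>0$ be a super-increasing sequence of weights (in decreasing order), let $q\in(0,w(N)]$ where $N=\{1,\dots,n\}$, and write $A(q)=\{a_0,\dots,a_r\}$ with $a_0<\dots<a_r$. Let $\varphi_i(q)$ be the Shapley value of agent $i$ in the weighted voting game with weights $w_1,\dots,w_n$ and quota $q$. For each $i\in N\setminus\{n\}$: (1) if $i,i+1$ both belong to $A(q)$ or both do not belong to $A(q)$, then $\varphi_i(q)=\varphi_{i+1}(q)$; (2) if $i\notin A(q)$ and $i+1\in A(q)$, then $\varphi_i(q)\ge\varphi_{i+1}(q)$, with equality if and only if $i+1=a_r$; (3) if $i\in A(q)$ and $i+1\notin A(q)$, then $\varphi_i(q)>\varphi_{i+1}(q)$.
   Context: Super-increasing (decreasing order): $w_i>\sum_{j=i+1}^n w_j$ for all $i\in N$. For $S\subseteq N$, $w(S)=\sum_{i\in S}w_i$ and $\beta(S)=\sum_{i\in S}2^{n-i}$. For non-empty $P\subseteq N$, $P^-\subseteq N$ is the unique subset with $\beta(P^-)=\beta(P)-1$. The intervals $(w(P^-),w(P)]$, over non-empty $P\subseteq N$, partition $(0,w(N)]$; $A(q)$ denotes the unique non-empty $P$ with $q\in(w(P^-),w(P)]$. Shapley value for quota $q$: with $v(S)=1$ if $w(S)\ge q$ and $v(S)=0$ otherwise, $\varphi_i(q)=\frac1{n!}\sum_{\sigma}(v(P_i(\sigma)\cup\{i\})-v(P_i(\sigma)))$, the sum over all permutations $\sigma$ of $N$, where $P_i(\sigma)=\{j:\sigma(j)<\sigma(i)\}$.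 *)

(* Defs.v *)
From mathcomp Require Import all_boot all_order all_algebra all_fingroup.

Set Implicit Arguments.
Unset Strict Implicit.
Unset Printing Implicit Defensive.

Import Order.TTheory GRing.Theory Num.Theory.
Local Open Scope ring_scope.

(* Agents are the elements of 'I_n, numbered from 0: the ordinal i stands for
   agent i + 1 of N = {1, ..., n}. *)

Definition super_increasing (R : realFieldType) (n : nat) (w : 'I_n -> R) :=
  forall i : 'I_n, \sum_(j < n | (i < j)%N) w j < w i.

Definition weight (R : realFieldType) (n : nat) (w : 'I_n -> R)
  (S : {set 'I_n}) : R := \sum_(i in S) w i.

(* The exponent n - i for the agent i of {1, ..., n} becomes n - i.+1. *)
Definition beta (n : nat) (S : {set 'I_n}) : nat :=
  (\sum_(i in S) 2 ^ (n - i.+1))%N.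

(* P^-, meaningful for non-empty P; see pred_setP. *)
Definition pred_set (n : nat) (P : {set 'I_n}) : {set 'I_n} :=
  odflt set0 [pick S | beta S == (beta P - 1)%N].

Definition in_interval (R : realFieldType) (n : nat) (w : 'I_n -> R) (q : R)
  (P : {set 'I_n}) : bool :=
  [&& P != set0, weight w (pred_set P) < q & q <= weight w P].

(* A(q), meaningful for super-increasing w and 0 < q <= w(N); see AsetP. *)
Definition Aset (R : realFieldType) (n : nat) (w : 'I_n -> R) (q : R) :
  {set 'I_n} := odflt set0 [pick P | in_interval w q P].

Definition winning (R : realFieldType) (n : nat) (w : 'I_n -> R) (q : R)
  (S : {set 'I_n}) : bool := q <= weight w S.

Definition predecessors (n : nat) (s : {perm 'I_n}) (i : 'I_n) :
  {set 'I_n} := [set j | (s j < s i)%N].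

Definition shapley (R : realFieldType) (n : nat) (w : 'I_n -> R) (q : R)
  (i : 'I_n) : R :=
  (n`!%:R)^-1 * \sum_(s : {perm 'I_n})
    ((winning w q (predecessors s i :|: [set i]))%:R
     - (winning w q (predecessors s i))%:R).

Lemma first_diff (n : nat) (S T : {set 'I_n}) : S != T ->
  exists k : 'I_n, (k \in S) != (k \in T) /\
    forall i : 'I_n, (i < k)%N -> (i \in S) = (i \in T).
Proof.
move=> neST.
have [k0 k0P] : exists k0 : 'I_n, (k0 \in S) != (k0 \in T).
  apply/existsP; apply: contraR neST; rewrite negb_exists => /forallP h.
  by apply/eqP/setP => i; move: (h i); rewrite negbK => /eqP.
case: (@arg_minnP _ k0 (fun k => (k \in S) != (k \in T)) val k0P) => k kP kmin.
exists k; split=> // i ltik; apply/eqP; apply: contraLR ltik => /kmin.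
by rewrite -leqNgt.
Qed.

Lemma weight_lt (R : realFieldType) (n : nat) (w : 'I_n -> R)
  (S T : {set 'I_n}) (k : 'I_n) :
  super_increasing w -> k \notin S -> k \in T ->
  (forall i : 'I_n, (i < k)%N -> (i \in S) = (i \in T)) ->
  weight w S < weight w T.
Proof.
move=> wS kS kT eqST.
have w_gt0 i : 0 < w i.
  have [m] := ubnP (n - i)%N; elim: m i => // m IH i le_m.
  apply: le_lt_trans (wS i); apply: sumr_ge0 => j ltij.
  apply/ltW/IH; apply: leq_trans (ltn_sub2l _ ltij) _ => //.
rewrite /weight (bigID (fun i : 'I_n => (i < k)%N)) /=.
rewrite [X in _ < X](bigID (fun i : 'I_n => (i < k)%N)) /=.
have -> : \sum_(i in S | (i < k)%N) w i = \sum_(i in T | (i < k)%N) w i.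
  apply: eq_bigl => i; case: ltnP => [/eqST -> //|]; by rewrite !andbF.
rewrite ltrD2l; apply: (@lt_le_trans _ _ (w k)).
  apply: le_lt_trans (wS k).
  rewrite big_mkcond [X in _ <= X]big_mkcond; apply: ler_sum => i _.
  case: (ltngtP i k) => [_|_|/val_inj ->]; rewrite ?andbF ?(negbTE kS) //=.
  by rewrite andbT; case: ifP => // _; apply: ltW.
rewrite (bigD1 k) /= ?kT ?ltnn // lerDl.
by apply: sumr_ge0 => i _; apply: ltW.
Qed.

Lemma super_increasing_pow2 (n : nat) :
  super_increasing (fun i : 'I_n => (2 ^ (n - i.+1))%:R : rat).
Proof.
move=> i; rewrite -natr_sum ltr_nat.
rewrite (reindex_inj rev_ord_inj) /=.
set m := (n - i.+1)%N.
have le_mn : (m <= n)%N by apply: leq_subr.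
rewrite (eq_big (fun j : 'I_n => (j < m)%N) (fun j : 'I_n => 2 ^ j)%N).
- rewrite -(big_ord_widen _ (fun j => 2 ^ j)%N le_mn).
  by move: (predn_exp 2 m); rewrite mul1n => <-; rewrite prednK // expn_gt0.
- by move=> j; rewrite /m !ltn_subRL !addSn addnC.
- by move=> j _; rewrite subnSK // subKn // ltnW.
Qed.

Lemma beta_weight (n : nat) (S : {set 'I_n}) :
  (beta S)%:R = weight (fun i : 'I_n => (2 ^ (n - i.+1))%:R : rat) S.
Proof. by rewrite natr_sum. Qed.

Lemma beta_inj (n : nat) : injective (@beta n).
Proof.
move=> S T eqb; apply/eqP; apply: contraTT (eqxx (beta S)) => /first_diff.
have sp := @super_increasing_pow2 n.
case=> k [kP kmin]; rewrite {2}eqb -(eqr_nat rat) !beta_weight.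
case kS: (k \in S) kP; case kT: (k \in T) => // _.
  rewrite gt_eqF //; apply: weight_lt sp _ kS _; rewrite ?kT // => i /kmin.
  by [].
by rewrite lt_eqF //; apply: weight_lt sp _ kT kmin; rewrite kS.
Qed.

Lemma beta_lt_weight (R : realFieldType) (n : nat) (w : 'I_n -> R)
  (S T : {set 'I_n}) :
  super_increasing w -> (beta S < beta T)%N = (weight w S < weight w T).
Proof.
move=> wS; have sp := @super_increasing_pow2 n.
have [->|/first_diff[k [kP kmin]]] := eqVneq S T; first by rewrite ltnn ltxx.
rewrite -(ltr_nat rat) !beta_weight.
have kmin' (i : 'I_n) (ik : (i < k)%N) := esym (kmin i ik).
case kS: (k \in S) kP; case kT: (k \in T) => // _; last first.
  by rewrite (weight_lt sp _ kT kmin) ?kS // (weight_lt wS _ kT kmin) ?kS.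
have kT' : k \notin T by rewrite kT.
by rewrite (lt_gtF (weight_lt sp kT' kS kmin')) (lt_gtF (weight_lt wS kT' kS kmin')).
Qed.

Lemma beta_bound (n : nat) (S : {set 'I_n}) : (beta S < 2 ^ n)%N.
Proof.
apply: (@leq_ltn_trans (\sum_(i < n) 2 ^ (n - i.+1))%N).
  rewrite /beta [X in (_ <= X)%N](bigID (mem S)) /=; exact: leq_addr.
rewrite (reindex_inj rev_ord_inj) /=.
rewrite (eq_bigr (fun j : 'I_n => 2 ^ j)%N); last first.
  by move=> j _; rewrite subnSK // subKn // ltnW.
by move: (predn_exp 2 n); rewrite mul1n => <-; rewrite prednK // expn_gt0.
Qed.

Lemma beta_surj (n m : nat) : (m < 2 ^ n)%N -> exists S : {set 'I_n}, beta S = m.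
Proof.
move=> lt_m.
pose f S : 'I_(2 ^ n) := Ordinal (@beta_bound n S).
have f_inj : injective f by move=> S T /(congr1 val) /beta_inj.
have : Ordinal lt_m \in codom f.
  apply: inj_card_onto => //.
  by rewrite card_ord -cardsT -powersetT card_powerset cardsT card_ord.
by case/codomP => S /(congr1 val) /= ->; exists S.
Qed.

Lemma beta_gt0 (n : nat) (P : {set 'I_n}) : (0 < beta P)%N = (P != set0).
Proof.
have b0 : beta (set0 : {set 'I_n}) = 0%N by rewrite /beta big_set0.
rewrite lt0n; congr (~~ _); apply/eqP/eqP => [|->//].
by rewrite -b0 => /beta_inj.
Qed.

Lemma pred_setP (n : nat) (P S : {set 'I_n}) : P != set0 ->
  (beta S = beta P - 1)%N <-> S = pred_set P.
Proof.
move=> _; rewrite /pred_set; case: pickP => [T /eqP bT | none] /=.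
  by rewrite -bT; split=> [/beta_inj|->].
have [T bT] : exists T : {set 'I_n}, beta T = (beta P - 1)%N.
  by apply: beta_surj; apply: leq_ltn_trans (leq_subr _ _) (beta_bound P).
by move: (none T); rewrite bT eqxx.
Qed.

Lemma AsetP (R : realFieldType) (n : nat) (w : 'I_n -> R) (q : R)
  (P : {set 'I_n}) :
  super_increasing w -> 0 < q -> q <= weight w [set: 'I_n] ->
  in_interval w q P <-> P = Aset w q.
Proof.
move=> wS q_gt0 q_le.
have uniqA S T : in_interval w q S -> in_interval w q T -> S = T.
  wlog ltST : S T / (beta S < beta T)%N.
    move=> IH hS hT; case: (ltngtP (beta S) (beta T)) => [l|l|/beta_inj //].
      exact: IH.
    by apply/esym/IH.
  case/and3P=> _ _ qS /and3P[T0 Tq _].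
  have bT := (pred_setP (pred_set T) T0).2 erefl.
  have : (beta S <= beta (pred_set T))%N.
    by rewrite bT -ltnS subn1 prednK // beta_gt0.
  rewrite leqNgt (beta_lt_weight _ _ wS) -leNgt => le.
  by have := lt_le_trans (le_lt_trans le Tq) qS; rewrite ltxx.
rewrite /Aset; case: pickP => [T hT | none] /=.
  by split=> [hP|-> //]; apply: uniqA.
case: (@arg_minnP _ [set: 'I_n] (fun P => q <= weight w P) (@beta n) q_le).
move=> S qS Smin.
have S0 : S != set0.
  by apply: contraTneq qS => ->; rewrite -ltNge /weight big_set0.
move: (none S); rewrite /in_interval S0 qS andbT /= ltNge => /negbFE /Smin.
rewrite ((pred_setP (pred_set S) S0).2 erefl) leqNgt subn1.
by rewrite prednK ?leqnn // beta_gt0.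
Qed.

(* Main.v *)
(* Pairing each ordering with the one in which i and j are exchanged shows that
   shapley i - shapley j is the average, over all orderings, of the terms
   v (i |: S) - v (j |: S), where S consists of the agents other than j placed
   before i, and every S avoiding i and j occurs.  When w j <= w i no term is
   negative, so the inequality is strict exactly when i |: S wins and j |: S
   loses for some such S.  A coalition wins iff it weighs at least as much as
   A(q), and super-increasing weights compare coalitions lexicographically; so
   for consecutive i, i' such an S must agree with A(q) below i, and its
   existence is read off the positions i, i' and the tail of A(q). *)

Require Import Defs.
From mathcomp Require Import all_boot all_order all_algebra all_fingroup.

Set Implicit Arguments.
Unset Strict Implicit.
Unset Printing Implicit Defensive.

Import Order.TTheory GRing.Theory Num.Theory.
Local Open Scope ring_scope.

(** * Differences of Shapley values and pivotal coalitions *)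

Lemma exists_predecessors (n : nat) (S : {set 'I_n}) (i : 'I_n) :
  i \notin S -> exists s : {perm 'I_n}, predecessors s i = S.
Proof.
(* The list [l] puts [S] first, then [i], then everyone else; the permutation sends each agent to
   its index in [l]. *)
move=> iS; pose l := enum S ++ i :: enum (~: (i |: S)).
have l_all x : x \in l.
  by rewrite mem_cat inE !mem_enum !inE; case: (x \in S); case: eqP.
have l_uniq : uniq l.
  rewrite cat_uniq /= !enum_uniq !mem_enum !inE eqxx (negbTE iS) /=.
  by rewrite andbT; apply/hasPn => x; rewrite !mem_enum !inE negb_or => /andP[].
have l_size : size l = n.
  rewrite -[RHS]card_ord -(card_uniqP l_uniq).
  by apply: eq_card => x; rewrite l_all.
have index_lt x : (index x l < n)%N by rewrite -[X in (_ < X)%N]l_size index_mem.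
have rank_inj : injective (fun x => Ordinal (index_lt x)).
  by move=> x y /(congr1 val) /= /index_inj; apply.
exists (perm rank_inj); apply/setP => x; rewrite inE !permE /= !index_cat.
rewrite !mem_enum (negbTE iS) /= eqxx addn0.
case: ifP => xS; last by rewrite ltnNge leq_addr.
by rewrite index_mem mem_enum.
Qed.

(** Reindexing by [tperm i j * s] gives [j] the rank that [i] has in [s]. With
    [P := predecessors s i], the two marginal contributions then share the subtracted term [P] if
    [j \notin P], and the coalition [i |: P] if [j \in P]; the shared term cancels. *)
Lemma shapley_sub (R : realFieldType) (n : nat) (w : 'I_n -> R) (q : R)
  (i j : 'I_n) : i != j ->
  shapley w q i - shapley w q j = (n`!%:R)^-1 * \sum_(s : {perm 'I_n})
    ((winning w q (i |: (predecessors s i :\ j)))%:R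
     - (winning w q (j |: (predecessors s i :\ j)))%:R).
Proof.
move=> neij; rewrite /shapley -mulrBr; congr (_ * _).
rewrite [X in _ - X](reindex_inj (mulgI (tperm i j))) -sumrB /=.
apply: eq_bigr => s _; set P := predecessors s i.
have iP : i \notin P by rewrite inE ltnn.
have -> : predecessors (tperm i j * s) j
  = if j \in P then i |: (P :\ j) else P.
  apply/setP => x; rewrite inE !permM tpermR -/P.
  case jP: (j \in P); case: tpermP => [->|->|/eqP/negbTE xi /eqP/negbTE xj];
    rewrite -?[(_ < _)%N]/(_ \in P) ?inE ?eqxx ?xi ?xj ?ltnn //=.
  - by move: jP; rewrite inE => ->.
  - by rewrite eq_sym (negbTE neij).
  - by move: jP; rewrite inE => ->.
  - by move: jP; rewrite inE => ->.
case jP: (j \in P); last first.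
  have -> : P :\ j = P by apply/setDidPl; rewrite disjoint_sym disjoints1 jP.
  by rewrite ![P :|: _]setUC opprB addrA subrK.
have -> : i |: (P :\ j) :|: [set j] = P :|: [set i].
  by rewrite setUC setUCA setD1K // setUC.
by rewrite (setD1K jP) opprB addrC addrA subrK.
Qed.

Lemma ler_natb (R : numDomainType) (b c : bool) :
  (b%:R <= c%:R :> R) = (b ==> c).
Proof. by rewrite ler_nat; case: b; case: c. Qed.

Definition pivotal (R : realFieldType) (n : nat) (w : 'I_n -> R) (q : R)
  (i j : 'I_n) (S : {set 'I_n}) : Prop :=
  [/\ i \notin S, j \notin S, ~~ winning w q (j |: S) & winning w q (i |: S)].

Lemma winning_exchange (R : realFieldType) (n : nat) (w : 'I_n -> R) (q : R)
  (i j : 'I_n) (S : {set 'I_n}) : i \notin S -> j \notin S -> w j <= w i ->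
  winning w q (j |: S) -> winning w q (i |: S).
Proof.
move=> iS jS wji; rewrite /winning /weight !big_setU1 //= => /le_trans; apply.
by rewrite lerD2r.
Qed.

Lemma shapley_le (R : realFieldType) (n : nat) (w : 'I_n -> R) (q : R)
  (i j : 'I_n) : i != j -> w j <= w i -> shapley w q j <= shapley w q i.
Proof.
move=> neij wji; rewrite -subr_ge0 shapley_sub // mulr_ge0 ?invr_ge0 //.
apply: sumr_ge0 => s _; rewrite subr_ge0 ler_natb.
by apply/implyP/winning_exchange; rewrite ?inE ?ltnn ?eqxx ?andbF.
Qed.

Lemma shapley_ltP (R : realFieldType) (n : nat) (w : 'I_n -> R) (q : R)
  (i j : 'I_n) : i != j -> w j <= w i ->
  shapley w q j < shapley w q i <-> exists S, pivotal w q i j S.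
Proof.
move=> neij wji; rewrite -subr_gt0 shapley_sub //.
rewrite pmulr_rgt0 ?invr_gt0 ?ltr0n ?fact_gt0 //.
pose d (s : {perm 'I_n}) : R :=
  (winning w q (i |: (predecessors s i :\ j)))%:R
  - (winning w q (j |: (predecessors s i :\ j)))%:R.
rewrite -[\sum_s _]/(\sum_s d s).
have d_ge0 s : 0 <= d s.
  rewrite subr_ge0 ler_natb.
  by apply/implyP/winning_exchange; rewrite ?inE ?ltnn ?eqxx ?andbF.
split=> [d_gt0|[S [iS jS lose win]]].
  have [s ds] : exists s, d s != 0.
    apply/existsP; apply: contraTT d_gt0; rewrite negb_exists => /forallP d0.
    by rewrite big1 ?ltxx // => s _; apply/eqP; move: (d0 s); rewrite negbK.
  exists (predecessors s i :\ j); move: (d_ge0 s) ds; rewrite /pivotal /d.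
  rewrite !inE ltnn eqxx andbF.
  case: (winning w q (j |: _)); case: (winning w q (i |: _)) => //;
    by rewrite ?subrr ?eqxx // sub0r oppr_ge0 ler10.
(* Take an ordering in which exactly [S] precedes [i]. As [j \notin S], removing [j] changes nothing
   and this ordering contributes 1. *)
have [s sP] := exists_predecessors iS.
rewrite (bigD1 s) //= ltr_pwDl ?sumr_ge0 //.
have -> : d s = 1.
  rewrite /d sP; have -> : S :\ j = S.
    by apply/setDidPl; rewrite disjoint_sym disjoints1.
  by rewrite win (negbTE lose) subr0.
exact: ltr01.
Qed.

(** * Lexicographic comparison of coalitions with A(q) *)

Lemma winning_Aset (R : realFieldType) (n : nat) (w : 'I_n -> R) (q : R)
  (S : {set 'I_n}) :
  super_increasing w -> 0 < q -> q <= weight w [set: 'I_n] ->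
  winning w q S = (weight w (Aset w q) <= weight w S).
Proof.
move=> wS q_gt0 q_le.
have /and3P[A0 predA qA] := (AsetP (Aset w q) wS q_gt0 q_le).2 erefl.
apply/idP/idP => [|/(le_trans qA) //].
(* A coalition lighter than A(q) has smaller [beta], hence at most that of [pred_set (Aset w q)], so
   it weighs at most as much as that set, which is below [q]. *)
apply: contraTT; rewrite -ltNge -(beta_lt_weight _ _ wS) => ltSA.
rewrite /winning -ltNge; apply: le_lt_trans predA.
rewrite leNgt -(beta_lt_weight _ _ wS).
rewrite ((pred_setP (pred_set (Aset w q)) A0).2 erefl) -leqNgt.
by rewrite -ltnS subn1 prednK // beta_gt0.
Qed.

Lemma weight_subset (R : realFieldType) (n : nat) (w : 'I_n -> R)
  (S T : {set 'I_n}) : (forall i, 0 < w i) -> S \subset T ->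
  weight w S <= weight w T.
Proof.
move=> w_gt0 sST; rewrite /weight [leRHS](big_setID S) /= (setIidPr sST).
by rewrite lerDl sumr_ge0 // => x _; apply: ltW.
Qed.

Lemma weight_proper (R : realFieldType) (n : nat) (w : 'I_n -> R)
  (S T : {set 'I_n}) : (forall i, 0 < w i) -> S \proper T ->
  weight w S < weight w T.
Proof.
move=> w_gt0 /properP[sST [x xT xS]].
apply: (@lt_le_trans _ _ (weight w (x |: S))).
  by rewrite /weight big_setU1 //= ltrDr.
by apply: weight_subset => //; rewrite subUset sub1set xT.
Qed.

(** Adding [i] or [j] does not change membership below [i]. At a first disagreement [x], either
    [x \in S] and [j |: S] outweighs [A], or [x \in A] and [i |: S] is lighter than [A]. *)
Lemma between_agree (R : realFieldType) (n : nat) (w : 'I_n -> R)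
  (A S : {set 'I_n}) (i j : 'I_n) : super_increasing w -> (i < j)%N ->
  weight w (j |: S) < weight w A -> weight w A <= weight w (i |: S) ->
  forall x : 'I_n, (x < i)%N -> (x \in S) = (x \in A).
Proof.
move=> wS ltij lo hi x; have [m] := ubnP x.
elim: m x => // m IH x; rewrite ltnS => le_xm ltxi.
have eqU (y k : 'I_n) : (y < i)%N -> (i <= k)%N -> (y \in k |: S) = (y \in S).
  move=> ltyi leik; rewrite !inE -val_eqE /= ltn_eqF //.
  exact: leq_trans leik.
have agree (y k : 'I_n) : (i <= k)%N -> (y < x)%N -> (y \in k |: S) = (y \in A).
  move=> leik ltyx; have ltyi := ltn_trans ltyx ltxi.
  by rewrite eqU // IH // (leq_trans ltyx).
case xS: (x \in S); case xA: (x \in A) => //.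
  have : weight w A < weight w (j |: S).
    apply: (weight_lt wS (k := x)); rewrite ?xA ?eqU ?(ltnW ltij) //.
    by move=> y ltyx; rewrite agree // ltnW.
  by rewrite (lt_gtF lo).
have : weight w (i |: S) < weight w A.
  apply: (weight_lt wS (k := x)); rewrite ?eqU ?xS //.
  by move=> y ltyx; rewrite agree.
by rewrite ltNge hi.
Qed.

(** Given agreement below [i], the index [j] decides: if [A] contains both, it outweighs [i |: S];
    if it contains neither, [j |: S] outweighs it. *)
Lemma between_succ (R : realFieldType) (n : nat) (w : 'I_n -> R)
  (A S : {set 'I_n}) (i j : 'I_n) : super_increasing w -> j = i.+1 :> nat ->
  i \notin S -> j \notin S ->
  weight w (j |: S) < weight w A -> weight w A <= weight w (i |: S) ->
  (i \in A) != (j \in A).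
Proof.
move=> wS ji iS jS lo hi; have ltij : (i < j)%N by rewrite ji.
have agree := between_agree wS ltij lo hi.
have neij : i != j by rewrite -val_eqE /= ltn_eqF.
have below (x : 'I_n) : (x < j)%N -> x = i \/ (x < i)%N.
  by rewrite ji ltnS leq_eqVlt => /orP[/eqP/val_inj|]; [left|right].
apply/negP => /eqP; case iA: (i \in A) => jA.
  have : weight w (i |: S) < weight w A.
    apply: (weight_lt wS (k := j)); rewrite -?jA //.
      by rewrite !inE negb_or eq_sym neij jS.
    move=> x /below[->|ltxi]; first by rewrite !inE eqxx iA.
    by rewrite !inE -val_eqE /= (ltn_eqF ltxi) agree.
  by rewrite ltNge hi.
have : weight w A < weight w (j |: S).
  apply: (weight_lt wS (k := j)); rewrite -?jA ?setU11 //.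
  move=> x /below[->|ltxi]; first by rewrite !inE (negbTE neij) (negbTE iS) iA.
  by rewrite !inE -val_eqE /= (ltn_eqF (ltn_trans ltxi ltij)) agree.
by rewrite (lt_gtF lo).
Qed.

(** * Comparison of consecutive agents *)

Theorem lemma6p3 (R : realFieldType) (n : nat) (w : 'I_n -> R)
  (w_decr : forall i j : 'I_n, (i < j)%N -> w j < w i)
  (w_pos : forall i : 'I_n, 0 < w i)
  (w_super : super_increasing w)
  (q : R) (q_pos : 0 < q) (q_le : q <= weight w [set: 'I_n])
  (r : nat) (a : 'I_r.+1 -> 'I_n)
  (a_incr : forall k l : 'I_r.+1, (k < l)%N -> (a k < a l)%N)
  (a_enum : Aset w q = [set a k | k : 'I_r.+1])
  (i i' : 'I_n) (i'_succ : i' = i.+1 :> nat) :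
  [/\ (i \in Aset w q /\ i' \in Aset w q) \/
      (i \notin Aset w q /\ i' \notin Aset w q) ->
      shapley w q i = shapley w q i',
      i \notin Aset w q -> i' \in Aset w q ->
      shapley w q i' <= shapley w q i /\
      (shapley w q i = shapley w q i' <-> i' = a ord_max) &
      i \in Aset w q -> i' \notin Aset w q ->
      shapley w q i' < shapley w q i].
Proof.
set A := Aset w q in a_enum *.
have ltii' : (i < i')%N by rewrite i'_succ.
have neii' : i != i' by rewrite -val_eqE /= ltn_eqF.
have w_le : w i' <= w i by apply/ltW/w_decr.
have winE S : winning w q S = (weight w A <= weight w S).
  exact: winning_Aset.
have pivotalE S : pivotal w q i i' S <-> [/\ i \notin S, i' \notin S,
    weight w (i' |: S) < weight w A & weight w A <= weight w (i |: S)].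
  by rewrite /pivotal !winE -ltNge.
have eqP' : shapley w q i = shapley w q i' <-> ~ exists S, pivotal w q i i' S.
  split=> [eq /shapley_ltP|no_pivot].
    by move=> /(_ neii' w_le); rewrite eq ltxx.
  apply/eqP; rewrite eq_le [X in _ && X]shapley_le // andbT leNgt.
  by apply/negP => /shapley_ltP-/(_ neii' w_le).
have below_i (j x : 'I_n) : (i <= j)%N -> (x < i)%N -> (x == j) = false.
  by move=> leij ltxi; rewrite -val_eqE /= ltn_eqF // (leq_trans ltxi).
split.
- move=> same; apply/eqP' => -[S /pivotalE[iS i'S lo hi]].
  have := between_succ w_super i'_succ iS i'S lo hi.
  by case: same => -[]; [move=> -> ->|move=> /negbTE-> /negbTE->].
- move=> iA i'A; split; first exact: shapley_le.
  have [k _ i'k] : exists2 k : 'I_r.+1, k \in 'I_r.+1 & i' = a k.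
    by apply/imsetP; rewrite -a_enum.
  split=> [/eqP' no_pivot|i'_last].
    apply/eqP/negPn/negP => i'_ne; apply: no_pivot.
    have lt_last : (i' < a ord_max)%N.
      rewrite i'k; apply: a_incr; rewrite ltn_neqAle -ltnS ltn_ord andbT.
      by apply: contra i'_ne => /eqP/val_inj <-; rewrite i'k.
    have lastA : a ord_max \in A by rewrite a_enum imset_f.
    (* The witness is the part of A(q) below [i]. Adding [i'] yields a proper subset of A(q),
       missing its last element; adding [i], which is not in A(q), already exceeds A(q) at [i]. *)
    exists [set x in A | (x < i)%N]; apply/pivotalE; split.
    + by rewrite inE ltnn andbF.
    + by rewrite inE ltnNge (ltnW ltii') andbF.
    + apply: weight_proper => //; apply/properP; split.
        by apply/subsetP => x; rewrite !inE => /orP[/eqP->|/andP[]].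
      exists (a ord_max) => //; rewrite !inE negb_or -val_eqE /= gtn_eqF //=.
      by rewrite ltnNge (ltnW (ltn_trans ltii' lt_last)) andbF.
    + apply/ltW/(weight_lt w_super (k := i)); rewrite ?setU11 // => x ltxi.
      by rewrite !inE below_i // ltxi andbT.
  apply/eqP' => -[S /pivotalE[iS i'S lo hi]].
  have agree := between_agree w_super ltii' lo hi.
  (* No element of A(q) lies beyond [i'], and [i] is not one, so agreement below [i] puts A(q)
     inside [i' |: S]. *)
  suff : weight w A <= weight w (i' |: S) by rewrite leNgt lo.
  apply: weight_subset => //; apply/subsetP => x xA.
  have le_xi' : (x <= i')%N.
    move: xA; rewrite a_enum => /imsetP[l _ ->]; rewrite i'_last.
    have [->//|ne] := eqVneq l ord_max.
    by apply/ltnW/a_incr; rewrite ltn_neqAle -ltnS ltn_ord andbT.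
  rewrite !inE; move: le_xi'; rewrite leq_eqVlt => /orP[/eqP/val_inj->|].
    by rewrite eqxx.
  rewrite i'_succ ltnS leq_eqVlt => /orP[/eqP/val_inj xi|ltxi].
    by rewrite -xi xA in iA.
  by rewrite agree // xA orbT.
(* The witness is A(q) without [i]: restoring [i] gives A(q) itself, while adding [i'] instead gives
   a set that first differs from A(q) by lacking [i]. *)
- move=> iA i'A; apply/shapley_ltP => //; exists (A :\ i); apply/pivotalE.
  split; rewrite ?setD1K //; first by rewrite !inE eqxx.
    by rewrite !inE (negbTE i'A) andbF.
  apply: (weight_lt w_super (k := i)) => // [|x ltxi].
    by rewrite !inE eqxx (negbTE neii').
  by rewrite !inE !below_i // ltnW.
Qed.
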